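(* Let $X,Y$ be independent random variables with distributions $F\in\mathcal{T}$ and $G\in\mathcal{A}$ respectively, with support $\mathbb{R}_+=[0,\infty)$, and let $F*G$ be the distribution of $X+Y$. If $$\limsup_{x\to\infty}\frac{\overline G(x)}{\overline F(x)}<\infty,$$ then $F\in\mathcal{A}$ if and only if $F*G\in\mathcal{A}$.
   Context: For a distribution $F$, $\overline F(x)=1-F(x)$ denotes its tail; all distributions satisfy $\overline F(x)>0$ for every $x\ge0$. Classes of distributions (on $\mathbb{R}_+$): - $F\in\mathcal{P_D}$ (positively decreasing) if $\limsup_{x\to\infty}\overline F(vx)/\overline F(x)<1$ for some $v>1$. - $F\in\mathcal{L}$ (long-tailed) if $\lim_{x\to\infty}\overline F(x-y)/\overline F(x)=1$ for every $y\ne 0$. - $F\in\mathcal{S}$ (subexponential) if $\lim_{x\to\infty}\overline{F^{*n}}(x)/\overline F(x)=n$ for every integer $n\ge2$, where $F^{*n}$ is the $n$-fold convolution of $F$. - $\mathcal{T}:=\mathcal{L}\cap\mathcal{P_D}$ and $\mathcal{A}:=\mathcal{S}\cap\mathcal{P_D}$. *)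

(* Defs.v *)
From HB Require Import structures.
From mathcomp Require Import all_boot all_order all_algebra.
From mathcomp Require Import all_classical all_reals all_analysis.
From mathcomp Require Import measurable_realfun.

Set Implicit Arguments.
Unset Strict Implicit.
Unset Printing Implicit Defensive.

Import Order.TTheory GRing.Theory Num.Theory.
Import numFieldNormedType.Exports.

Local Open Scope classical_set_scope.
Local Open Scope ring_scope.

Section tail_classes.
Context {R : realType}.
Implicit Types F G : probability R R.

Definition tail F (x : R) : R := 1 - fine (F `]-oo, x]%classic).

(* F is carried by [0, +oo[; the closed support of F may be a proper subset. *)
Definition supported_on_Rplus F : Prop := F `]-oo, 0[%classic = 0%E.

Definition positively_decreasing F : Prop :=
  exists2 v : R, 1 < v &
    (limf_esup (fun x : R => (tail F (v * x) / tail F x)%:E) +oo%R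
      < 1)%E.

Definition long_tailed F : Prop :=
  forall y : R, y != 0 ->
    tail F (x - y) / tail F x @[x --> +oo] --> (1 : R).

Definition add_pair (z : R * R) : R := z.1 + z.2.

Lemma measurable_add_pair : measurable_fun [set: _] add_pair.
Proof.
by apply: measurable_funD; [exact: measurable_fst|exact: measurable_snd].
Qed.

HB.instance Definition _ :=
  @isMeasurableFun.Build _ _ _ _ add_pair measurable_add_pair.

Definition convolution F G : probability R R :=
  distribution (F \x G)%E add_pair.

(* The n-fold convolution F^{*n} for n >= 1 (so F^{*1} = F); n = 0 is junk. *)
Definition nconvolution F (n : nat) : probability R R :=
  iter n.-1 (convolution F) F.

Definition subexponential F : Prop :=
  forall n : nat, (2 <= n)%N ->
    tail (nconvolution F n) x / tail F x @[x --> +oo] --> (n%:R : R).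

Definition classT F : Prop := long_tailed F /\ positively_decreasing F.

Definition classA F : Prop := subexponential F /\ positively_decreasing F.

End tail_classes.

Definition independent_RV {d} {T : measurableType d} {R : realType}
    (P : probability T R) (X Y : {RV P >-> R}) : Prop :=
  forall A B : set R, measurable A -> measurable B ->
    P (X @^-1` A `&` Y @^-1` B) = (P (X @^-1` A) * P (Y @^-1` B))%E.

(* Main.v *)
Require Import Defs.
From HB Require Import structures.
From mathcomp Require Import all_boot all_order all_algebra.
From mathcomp Require Import all_classical all_reals all_analysis.
From mathcomp Require Import measurable_realfun.
From mathcomp Require Import ring lra.

(* Idea. For independent X ~ F and Y ~ G, put
   J_A(F, G)(x) = P(X > A, Y > A, X + Y > x). Splitting according to which of
   X, Y exceeds A, the tail of F * G at x is, for long-tailed F and G,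
   asymptotically F(x, oo) + G(x, oo), up to J_A(F, G)(x). A long-tailed F is
   subexponential iff J_A(F, F)(x) = o(F(x, oo)), as x and then A tend to
   infinity. By Fubini, J_A is monotone in the tails: if the tail of G is at
   most C times the tail of H beyond A, then J_A(F, G) <= C J_A(F, H).
   If F is subexponential, all the tails of G, F * G are O of the tail of F, so
   J_A(F * G, F * G) is dominated by J_A(F, F). Conversely, the tails of F and
   G are below that of H = F * G, so J_A(F, G) and J_A(F, F) are dominated by
   J_A(H, H) = o(H(x, oo)); the first bound gives H(x, oo) = O(F(x, oo)), and
   then the second one is the subexponentiality of F. *)

Set Implicit Arguments.
Unset Strict Implicit.

Import Order.TTheory GRing.Theory Num.Theory.
Import numFieldNormedType.Exports.

Local Open Scope classical_set_scope.
Local Open Scope ring_scope.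

(** * Tails, and elementary bounds on the tail of a convolution *)

Section tails.
Context {R : realType}.
Implicit Types F G : probability R R.

Lemma tailE F (x : R) : F `]x, +oo[%classic = (tail F x)%:E.
Proof.
have -> : `]x, +oo[%classic = ~` (`]-oo, x]%classic : set R).
  by rewrite setCitvl.
rewrite probability_setC; last exact: measurable_itv.
rewrite /tail EFinB fineK //; exact: fin_num_measure.
Qed.

Lemma tail_ge0 F x : 0 <= tail F x.
Proof. by rewrite -lee_fin -tailE. Qed.

Lemma tail_le1 F x : tail F x <= 1.
Proof. by rewrite -lee_fin -tailE; apply: probability_le1; exact: measurable_itv. Qed.

Lemma tail_nonincreasing F : {homo tail F : x y / x <= y >-> y <= x}.
Proof.
move=> x y xy; rewrite -lee_fin -!tailE; apply: le_measure; rewrite ?inE.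
- exact: measurable_itv.
- exact: measurable_itv.
- by move=> z /=; rewrite !in_itv /= !andbT; exact: le_lt_trans.
Qed.

(** Under [F] the identity is a random variable with law [F], so [tail F] is its [ccdf], whose limit
    at infinity is known. *)
Let idR : R -> R := idfun.

#[local] HB.instance Definition _ :=
  @isMeasurableFun.Build _ _ R R idR (@measurable_id _ R setT).

Lemma tail_cvg0 F : tail F x @[x --> +oo] --> (0 : R).
Proof.
have /fine_cvg := @cvg_ccdfy0 _ R R F idR.
rewrite /=; apply: cvg_trans; apply: near_eq_cvg; apply: nearW => x.
by rewrite /= /ccdf /distribution /pushforward /= preimage_id tailE.
Qed.

Lemma itv0E F A : supported_on_Rplus F -> 0 <= A ->
  F `[0, A]%classic = (1 - tail F A)%:E.
Proof.
move=> F0 A0; rewrite /tail subKr fineK; last exact: fin_num_measure.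
have -> : `]-oo, A]%classic = (`]-oo, 0[ `|` `[0, A])%classic :> set R.
  apply/seteqP; split=> z /=; rewrite !in_itv /=.
    by case: (ltP z 0) => ? ?; [left|right].
  by case=> [/ltW z0|/andP[]//]; exact: le_trans A0.
rewrite measureU//; first by rewrite [X in (X + _)%E]F0 add0e.
apply/seteqP; split=> z //= []; rewrite !in_itv /= => z0 /andP[].
by rewrite leNgt z0.
Qed.

(* [add_pair] alone would be the MathComp constant that shadows [Defs.add_pair]. *)
Definition both_exceed (A x : R) : set (R * R) :=
  (`]A, +oo[ `*` `]A, +oo[) `&` @Defs.add_pair R @^-1` `]x, +oo[.

Definition bigjump F G A x : R := fine ((F \x G)%E (both_exceed A x)).

Lemma measurable_sum_gt (x : R) :
  measurable (@Defs.add_pair R @^-1` `]x, +oo[%classic).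
Proof. by rewrite -[X in measurable X]setTI; exact: measurable_add_pair. Qed.

Lemma measurable_both_exceed A x : measurable (both_exceed A x).
Proof.
apply: measurableI; last exact: measurable_sum_gt.
by apply: measurableX.
Qed.

Lemma bigjumpE F G A x : (F \x G)%E (both_exceed A x) = (bigjump F G A x)%:E.
Proof.
rewrite /bigjump fineK//; apply: (fin_num_measure ((F \x G)%E : probability (R * R)%type R)).
exact: measurable_both_exceed.
Qed.

Lemma tail_convolutionE F G x :
  (tail (convolution F G) x)%:E = (F \x G)%E (@Defs.add_pair R @^-1` `]x, +oo[).
Proof. by rewrite -tailE. Qed.

Lemma measure_add3_le (p : probability (R * R)%type R) (B1 B2 B3 C : set (R * R)) :
  measurable B1 -> measurable B2 -> measurable B3 -> measurable C ->
  B1 `<=` C -> B2 `<=` C -> B3 `<=` C ->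
  B1 `&` B2 = set0 -> B1 `&` B3 = set0 -> B2 `&` B3 = set0 ->
  (p B1 + p B2 + p B3 <= p C)%E.
Proof.
move=> m1 m2 m3 mC s1 s2 s3 d12 d13 d23.
rewrite -measureU// -measureU//; last 2 first.
- exact: measurableU.
- by rewrite setIUl d13 d23 setU0.
apply: le_measure; rewrite ?inE//; first by apply: measurableU => //; exact: measurableU.
by move=> z [[]|]; [exact: s1|exact: s2|exact: s3].
Qed.

Lemma measure_le_add3 (p : probability (R * R)%type R) (B1 B2 B3 C : set (R * R)) :
  measurable B1 -> measurable B2 -> measurable B3 -> measurable C ->
  C `<=` B1 `|` B2 `|` B3 ->
  (p C <= p B1 + p B2 + p B3)%E.
Proof.
move=> m1 m2 m3 mC s.
apply: le_trans (_ : (p (B1 `|` B2 `|` B3) <= _)%E).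
  apply: le_measure; rewrite ?inE//; apply: measurableU => //; exact: measurableU.
apply: (le_trans (measureU2 p (measurableU _ _ m1 m2) m3)).
by apply: leeD2r; exact: (measureU2 p).
Qed.

(** Three disjoint events force X + Y > x: one variable exceeds [x] while the other lies in [0, A]
    (two ways), or [both_exceed]. The condition [A <= x] separates the first two. *)
Lemma tail_convolution_ge F G A x :
  supported_on_Rplus F -> supported_on_Rplus G -> 0 <= A -> A <= x ->
  tail F x * (1 - tail G A) + tail G x * (1 - tail F A) + bigjump F G A x
    <= tail (convolution F G) x.
Proof.
move=> F0 G0 A0 Ax.
rewrite -lee_fin tail_convolutionE 2!EFinD -bigjumpE (mulrC (tail G x)) !EFinM.
rewrite -!itv0E// -!tailE -!product_measure1E//.
apply: (measure_add3_le ((F \x G)%E : probability (R * R)%type R)).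
- exact: measurableX.
- exact: measurableX.
- exact: measurable_both_exceed.
- exact: measurable_sum_gt.
- move=> [u v] /=; rewrite /Defs.add_pair /= !in_itv /= !andbT; lra.
- move=> [u v] /=; rewrite /Defs.add_pair /= !in_itv /= !andbT; lra.
- by move=> z [].
- apply/seteqP; split=> // -[u v] /=; rewrite !in_itv /= !andbT; lra.
- apply/seteqP; split=> // -[u v] [] /=; rewrite /both_exceed /= !in_itv /= !andbT; lra.
- apply/seteqP; split=> // -[u v] [] /=; rewrite /both_exceed /= !in_itv /= !andbT; lra.
Qed.

(** If X + Y > x, then X <= A forces Y > x - A, Y <= A forces X > x - A, and otherwise both exceed
    A. *)
Lemma tail_convolution_le F G A x :
  tail (convolution F G) x
    <= tail F (x - A) + tail G (x - A) + bigjump F G A x.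
Proof.
rewrite -lee_fin tail_convolutionE 2!EFinD -bigjumpE -!tailE.
have -> : F `]x - A, +oo[%classic = (F \x G)%E (`]x - A, +oo[%classic `*` setT).
  by rewrite product_measure1E// [X in (_ * X)%E](probability_setT G) mule1.
have -> : G `]x - A, +oo[%classic = (F \x G)%E (setT `*` `]x - A, +oo[%classic).
  by rewrite product_measure1E// [X in (X * _)%E](probability_setT F) mul1e.
apply: (measure_le_add3 ((F \x G)%E : probability (R * R)%type R)).
- exact: measurableX.
- exact: measurableX.
- exact: measurable_both_exceed.
- exact: measurable_sum_gt.
- move=> [u v] /=; rewrite /both_exceed /Defs.add_pair /= !in_itv /= !andbT => xuv.
  case: (leP u A) => uA; first by left; right; split=> //; lra.
  case: (leP v A) => vA; first by left; left; split=> //; lra.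
  by right; split.
Qed.

(* Disjoint events: X > x; X <= y and Y > x; y < X <= x and Y > x - y. *)
Lemma tail_convolution_ge_shift F G y x :
  supported_on_Rplus F -> supported_on_Rplus G -> 0 <= y -> y <= x ->
  tail F x + (1 - tail F y) * tail G x + (tail F y - tail F x) * tail G (x - y)
    <= tail (convolution F G) x.
Proof.
move=> F0 G0 y0 yx.
have FyxE : F `]y, x]%classic = (tail F y - tail F x)%:E.
  have h : (tail F y)%:E = (F `]y, x]%classic + (tail F x)%:E)%E.
    rewrite -!tailE -measureU//.
      congr (F _); apply/seteqP; split=> z /=; rewrite !in_itv /= !andbT.
        by move=> ->/=; case: (leP z x); [left|right].
      by case=> [/andP[]//|]; exact: le_lt_trans.
    by apply/seteqP; split=> // z /= []; rewrite !in_itv /= !andbT; lra.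
  by rewrite EFinB h addeK.
have GE : G `[0, +oo[%classic = 1%E.
  have -> : `[0, +oo[%classic = ~` (`]-oo, 0[%classic : set R) by rewrite setCitvl.
  by rewrite probability_setC// G0 sube0.
rewrite -lee_fin tail_convolutionE 2!EFinD 2!EFinM -itv0E// -FyxE.
rewrite -[X in (X + _ + _)%E]mule1 -GE -!tailE -!product_measure1E//.
apply: (measure_add3_le ((F \x G)%E : probability (R * R)%type R)).
- exact: measurableX.
- exact: measurableX.
- exact: measurableX.
- exact: measurable_sum_gt.
- move=> [u v] /=; rewrite /Defs.add_pair /= !in_itv /= !andbT; lra.
- move=> [u v] /=; rewrite /Defs.add_pair /= !in_itv /= !andbT; lra.
- move=> [u v] /=; rewrite /Defs.add_pair /= !in_itv /= !andbT; lra.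
- apply/seteqP; split=> // -[u v] /=; rewrite !in_itv /= !andbT; lra.
- apply/seteqP; split=> // -[u v] [] /=; rewrite !in_itv /= !andbT; lra.
- apply/seteqP; split=> // -[u v] [] /=; rewrite !in_itv /= !andbT; lra.
Qed.

End tails.

(** * Comparison and symmetry of the big-jump probability; support of a convolution *)

Section bigjump.
Context {R : realType}.
Implicit Types F G H : probability R R.

Lemma bigjump_ge0 F G A x : 0 <= bigjump F G A x.
Proof. by rewrite /bigjump fine_ge0. Qed.

Lemma xsection_both_exceed (A x y : R) :
  xsection (both_exceed A x) y =
    if A < y then `]Num.max A (x - y), +oo[%classic else set0.
Proof.
apply/seteqP; split=> z; rewrite /xsection /both_exceed /Defs.add_pair /=.
  rewrite inE /= !in_itv /= !andbT => -[[Ay Az] xyz].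
  by rewrite Ay /= in_itv /= andbT gt_max Az /=; lra.
case: ifPn => //= Ay; rewrite inE /= !in_itv /= !andbT gt_max => /andP[Az xyz].
by split=> //; lra.
Qed.

(** Each nonempty section of the event is a half-line starting at [Num.max A (x - y)], so only tails
    at points beyond [A] are integrated against [F], and they compare pointwise. *)
Lemma bigjump_le F G H (C A x : R) : 0 <= C ->
  (forall y, A <= y -> tail G y <= C * tail H y) ->
  bigjump F G A x <= C * bigjump F H A x.
Proof.
move=> C0 GH; rewrite -lee_fin EFinM -!bigjumpE /product_measure1.
rewrite -ge0_integralZl//; last first.
  exact: (measurable_fun_xsection H (measurable_both_exceed A x)).
apply: ge0_le_integral => //.
- exact: (measurable_fun_xsection G (measurable_both_exceed A x)).
- apply: measurable_funeM.
  exact: (measurable_fun_xsection H (measurable_both_exceed A x)).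
move=> y _ /=; rewrite xsection_both_exceed; case: ifPn => Ay.
  rewrite !tailE -EFinM lee_fin; apply: GH.
  by rewrite le_max lexx.
by rewrite !measure0 mule0.
Qed.

(** The event is invariant under swapping coordinates, and uniqueness of the product measure allows
    the other order of integration. *)
Lemma bigjumpC F G A x : bigjump F G A x = bigjump G F A x.
Proof.
rewrite /bigjump; congr fine.
rewrite (@product_measure_unique _ _ _ _ _ F G (F \x^ G)%E) //; last first.
- exact: measurable_both_exceed.
- by move=> B1 B2 m1 m2; exact: product_measure2E.
rewrite /product_measure1 /product_measure2; apply: eq_integral => y _ /=.
congr (F _); apply/seteqP; split=> z; rewrite /xsection /ysection /= !inE;
  by rewrite /both_exceed /Defs.add_pair /= addrC => -[[]].
Qed.

(** A negative sum has a negative summand, so the event lies in the union of two null strips. *)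
Lemma convolution_supported F G :
  supported_on_Rplus F -> supported_on_Rplus G ->
  supported_on_Rplus (convolution F G).
Proof.
move=> F0 G0; rewrite /supported_on_Rplus.
have mS : measurable (@Defs.add_pair R @^-1` `]-oo, 0[%classic).
  by rewrite -[X in measurable X]setTI; exact: measurable_add_pair.
set p : probability (R * R)%type R := (F \x G)%E.
have m1 : measurable (`]-oo, 0[%classic `*` [set: R] : set (R * R)).
  exact: measurableX.
have m2 : measurable ([set: R] `*` `]-oo, 0[%classic : set (R * R)).
  exact: measurableX.
apply/eqP; rewrite -measure_le0.
apply: (@le_trans _ _ (p (`]-oo, 0[%classic `*` [set: R] `|`
    [set: R] `*` `]-oo, 0[%classic))).
  apply: (@le_measure _ _ _ p (@Defs.add_pair R @^-1` `]-oo, 0[%classic)); rewrite ?inE//; first exact: measurableU.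
  move=> [u v] /=; rewrite /Defs.add_pair /= !in_itv /= => uv.
  by case: (ltP u 0) => u0; [left|right; split=> //; lra].
apply: (le_trans (measureU2 p m1 m2)).
rewrite /p /= !product_measure1E//.
by rewrite [X in (X * _ + _)%E]F0 [X in (_ + _ * X)%E]G0 mul0e mule0 adde0.
Qed.

End bigjump.

(** * The law of a sum of independent variables *)

Section sum_of_independent.
Context {d} {T : measurableType d} {R : realType} {P : probability T R}.

(** Independence makes the joint law of (X, Y) agree with the product on rectangles, hence on the
    preimage of [B] under addition. *)
Lemma distribution_sum (X Y : {RV P >-> R}) (B : set R) :
  independent_RV X Y -> measurable B ->
  distribution P (X \+ Y) B =
  convolution (distribution P X : probability R R) (distribution P Y) B.
Proof.
move=> XY mB.
have mXY : measurable_fun setT (fun t : T => (X t, Y t) : R * R).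
  exact/measurable_fun_pair.
pose XYm := @isMeasurableFun.Build _ _ T (R * R)%type _ mXY.
pose Z : {mfun T >-> (R * R)%type} := HB.pack (fun t : T => (X t, Y t) : R * R) XYm.
pose F : probability R R := distribution P X.
pose G : probability R R := distribution P Y.
have mS : measurable (@Defs.add_pair R @^-1` B).
  by rewrite -[X in measurable X]setTI; exact: measurable_add_pair.
have ZE A1 A2 : measurable A1 -> measurable A2 ->
    distribution P Z (A1 `*` A2) = (F A1 * G A2)%E by exact: XY.
exact/esym/(product_measure_unique ZE mS).
Qed.

End sum_of_independent.

(** * Limits of ratios and functions insensitive to shifts *)

Section ratio.
Context {R : realType}.
Implicit Types f g h : R -> R.

(** Trades a limit of quotients for linear inequalities without division, the form in which later
    estimates are combined. *)
Lemma ratio_cvgP h g (c : R) : (forall x, 0 < g x) ->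
  h x / g x @[x --> +oo] --> c <->
  forall e, 0 < e -> \forall x \near +oo, (c - e) * g x <= h x <= (c + e) * g x.
Proof.
move=> g0; have hE x : h x = h x / g x * g x by rewrite divfK// gt_eqF.
split=> [/cvgrPdist_le H e e0|H].
  near=> x; have : `|c - h x / g x| <= e by near: x; exact: H.
  rewrite (hE x) mulfK ?gt_eqF// ler_norml !ler_pM2r// => /andP[? ?].
  by apply/andP; split; lra.
apply/cvgrPdist_le => e e0; near=> x.
have : (c - e) * g x <= h x <= (c + e) * g x by near: x; exact: H.
rewrite (hE x) mulfK ?gt_eqF// !ler_pM2r// ler_norml => /andP[? ?].
by apply/andP; split; lra.
Unshelve. all: by end_near. Qed.

Lemma near_shift (P : R -> Prop) (y : R) :
  (\forall x \near +oo, P x) -> \forall x \near +oo, P (x - y).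
Proof.
move=> [M [Mr PM]]; near=> x; apply: PM.
by rewrite ltrBrDr; near: x; apply: nbhs_pinfty_gt; rewrite num_real.
Unshelve. all: by end_near. Qed.

(** [long_tailed] for arbitrary functions, so that it also applies to sums of two tails;
    [slow (tail F)] unfolds to [long_tailed F]. *)
Definition slow f := forall y : R, y != 0 -> f (x - y) / f x @[x --> +oo] --> (1 : R).

(** Factor f(x - y)/f(x) through [g]: the three factors tend to c, 1 and 1/c. *)
Lemma slow_equiv f g : (forall x, 0 < f x) -> (forall x, 0 < g x) ->
  forall c : R, 0 < c -> f x / g x @[x --> +oo] --> c -> slow g -> slow f.
Proof.
move=> f0 g0 c c0 fg sg y y0.
have fgy : f (x - y) / g (x - y) @[x --> +oo] --> c.
  by move=> B /fg; exact: (@near_shift (fun x => B (f x / g x))).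
have : f (x - y) / g (x - y) * (g (x - y) / g x) * (f x / g x)^-1
    @[x --> +oo] --> c * 1 * c^-1.
  by apply: cvgM; [apply: cvgM => //; exact: sg|apply: cvgV => //; rewrite gt_eqF].
rewrite mulr1 divff ?gt_eqF//; apply: cvg_trans; apply: near_eq_cvg.
apply: nearW => x; field.
by rewrite !gt_eqF.
Qed.

Lemma slow_near f (y e : R) : (forall x, 0 < f x) -> slow f -> y != 0 -> 0 < e ->
  \forall x \near +oo, (1 - e) * f x <= f (x - y) <= (1 + e) * f x.
Proof.
by move=> f0 sf y0; apply: (ratio_cvgP (fun x => f (x - y)) 1 f0).1; exact: sf.
Qed.

Lemma slowD f g : (forall x, 0 < f x) -> (forall x, 0 < g x) ->
  slow f -> slow g -> slow (fun x => f x + g x).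
Proof.
move=> f0 g0 sf sg y y0.
have fg0 x : 0 < f x + g x by rewrite addr_gt0.
apply: (ratio_cvgP (fun x => f (x - y) + g (x - y)) 1 fg0).2 => e e0.
near=> x.
have : (1 - e) * f x <= f (x - y) <= (1 + e) * f x.
  by near: x; exact: slow_near.
have : (1 - e) * g x <= g (x - y) <= (1 + e) * g x.
  by near: x; exact: slow_near.
by rewrite !mulrDr; lra.
Unshelve. all: by end_near. Qed.

(** Monotonicity gives one of the two bounds for either sign of [y]; for negative [y], the other
    comes from the hypothesis with shift [- y] at the point [x - y]. *)
Lemma slowP f : (forall x, 0 < f x) -> {homo f : x y / x <= y >-> y <= x} ->
  (forall y e, 0 < y -> 0 < e -> \forall x \near +oo, f (x - y) <= (1 + e) * f x) ->
  slow f.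
Proof.
move=> f0 mf H y; rewrite neq_lt => /orP[y0|y0];
  apply: (ratio_cvgP (fun x => f (x - y)) 1 f0).2 => e e0; last first.
  near=> x; apply/andP; split.
    rewrite (@le_trans _ _ (f x))//; last by apply: mf; rewrite gerBl ltW.
    by rewrite ger_pMl// gerBl ltW.
  by near: x; exact: H.
near=> x; apply/andP; split; last first.
  rewrite (@le_trans _ _ (f x))//; first by apply: mf; rewrite lerBrDl gerDr ltW.
  by rewrite ler_peMl ?ltW// ltrDl.
have : f (x - y + y) <= (1 + e) * f (x - y).
  near: x; apply: (@near_shift (fun x => f (x + y) <= (1 + e) * f x)).
  by rewrite -(opprK y); apply: H => //; rewrite oppr_gt0.
rewrite subrK => h.
(* For [1 <= e] the lower bound is nonpositive; otherwise (1 - e)(1 + e) <= 1 suffices. *)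
have [e1|e1] := leP 1 e.
  by have := f0 x; have := f0 (x - y); nra.
rewrite (@le_trans _ _ ((1 - e) * ((1 + e) * f (x - y))))//.
  by rewrite ler_wpM2l//; lra.
rewrite mulrA ger_pMl//; nra.
Unshelve. all: by end_near. Qed.

End ratio.

(** * Negligibility of the big-jump probability *)

Section negligible_bigjump.
Context {R : realType}.
Implicit Types (F G H : probability R R) (s t : R -> R).

(** An iterated limit: [A] is chosen first, and the threshold for [x] may depend on it. *)
Definition bigjump_negligible F G t : Prop := forall e : R, 0 < e ->
  \forall A \near +oo, \forall x \near +oo, bigjump F G A x <= e * t x.

Lemma bigjump_negligibleC F G t :
  bigjump_negligible F G t -> bigjump_negligible G F t.
Proof.
move=> FG e /FG; apply: filterS => A; apply: filterS => x.
by rewrite bigjumpC.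
Qed.

Lemma bigjump_negligible_le F G H t (C : R) :
  (\forall x \near +oo, tail G x <= C * tail H x) ->
  bigjump_negligible F H t -> bigjump_negligible F G t.
Proof.
(* No sign is assumed for [C]; [D] is a positive constant that may divide [e]. *)
move=> GH FH e e0; pose D := Num.max C 1.
have D0 : 0 < D by rewrite lt_max ltr01 orbT.
have [M [_ GHM]] := GH.
have := FH _ (divr_gt0 e0 D0); apply: filterS2 (nbhs_pinfty_gt (num_real M)) => A MA.
apply: filterS => x FHe.
rewrite (@le_trans _ _ (D * bigjump F H A x))//.
  apply: bigjump_le => [|y Ay]; first exact: ltW.
  apply: le_trans (GHM _ _) _; first exact: lt_le_trans Ay.
  by rewrite ler_wpM2r ?tail_ge0// le_max lexx.
rewrite (@le_trans _ _ (D * (e / D * t x)))//; first by rewrite ler_pM2l.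
by rewrite mulrA mulrCA divff ?gt_eqF// mulr1.
Qed.

Lemma bigjump_negligible_weaken F G s t (C : R) : 0 < C ->
  (\forall x \near +oo, t x <= C * s x) ->
  bigjump_negligible F G t -> bigjump_negligible F G s.
Proof.
move=> C0 ts FG e e0; have := FG _ (divr_gt0 e0 C0).
apply: filterS => A; apply: filterS2 ts => x ts FGe.
rewrite (le_trans FGe)// -mulrA ler_pM2l// mulrC ler_pdivrMr//.
by rewrite mulrC.
Qed.

Lemma tail_small F (e : R) : 0 < e -> \forall x \near +oo, tail F x <= e.
Proof.
move=> e0; have /cvgrPdist_le/(_ e e0) := tail_cvg0 F.
by apply: filterS => x; rewrite sub0r normrN ger0_norm ?tail_ge0.
Qed.

End negligible_bigjump.

(** * Convolution asymptotics and the characterization of subexponentiality *)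

Section asymptotics.
Context {R : realType}.
Implicit Types (F G K : probability R R).

Lemma tail_gt0 F : (forall x, 0 <= x -> 0 < tail F x) -> forall x, 0 < tail F x.
Proof.
move=> F0 x; apply: lt_le_trans (F0 (Num.max 0 x) _) _; first by rewrite le_max lexx.
by apply: tail_nonincreasing; rewrite le_max lexx orbT.
Qed.

Lemma tail_convolution_ge_max F G x :
  supported_on_Rplus F -> supported_on_Rplus G -> 0 <= x ->
  Num.max (tail F x) (tail G x) <= tail (convolution F G) x.
Proof.
(* At shift 0 the bound sums to F + G - FG in the tails at [x], which dominates each tail since both
   lie in [0, 1]. *)
move=> F0 G0 x0; apply: le_trans (tail_convolution_ge_shift F0 G0 (lexx 0) x0).
rewrite subr0 ge_max; have := tail_le1 F x; have := tail_le1 G x.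
have := tail_ge0 F x; have := tail_ge0 G x; nra.
Qed.

Lemma tail_convolution_equiv F G :
  supported_on_Rplus F -> supported_on_Rplus G ->
  (forall x, 0 < tail F x) -> (forall x, 0 < tail G x) ->
  long_tailed F -> long_tailed G ->
  bigjump_negligible F G (fun x => tail F x + tail G x) ->
  tail (convolution F G) x / (tail F x + tail G x) @[x --> +oo] --> (1 : R).
Proof.
move=> Fs Gs F0 G0 FL GL FG.
have FG0 x : 0 < tail F x + tail G x by rewrite addr_gt0.
apply: (ratio_cvgP (tail (convolution F G)) 1 FG0).2 => e e0.
(* Upper bound: [e / 2] pays for the shift by [A] and [e / 2] for [bigjump]. Lower bound: [bigjump]
   is dropped and the tails at [A] cost [e]. *)
have e20 : 0 < e / 2 by rewrite divr_gt0.
near (pinfty_nbhs R) => A.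
have A0 : 0 < A by near: A; apply: nbhs_pinfty_gt; rewrite num_real.
have FA : tail F A <= e by near: A; exact: tail_small.
have GA : tail G A <= e by near: A; exact: tail_small.
have FGA : \forall x \near +oo, bigjump F G A x <= e / 2 * (tail F x + tail G x).
  by near: A; exact: FG.
near=> x.
have /andP[_ FxA] : (1 - e / 2) * tail F x <= tail F (x - A) <= (1 + e / 2) * tail F x.
  by near: x; apply: (slow_near F0 FL) => //; rewrite gt_eqF.
have /andP[_ GxA] : (1 - e / 2) * tail G x <= tail G (x - A) <= (1 + e / 2) * tail G x.
  by near: x; apply: (slow_near G0 GL) => //; rewrite gt_eqF.
have J : bigjump F G A x <= e / 2 * (tail F x + tail G x) by near: x.
have Ax : A <= x by near: x; apply: nbhs_pinfty_ge; rewrite num_real.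
have J0 := bigjump_ge0 F G A x.
have le1 := tail_convolution_ge Fs Gs (ltW A0) Ax.
have le2 := tail_convolution_le F G A x.
have lF : tail F x * (1 - e) <= tail F x * (1 - tail G A).
  by rewrite ler_pM2l//; lra.
have lG : tail G x * (1 - e) <= tail G x * (1 - tail F A).
  by rewrite ler_pM2l//; lra.
apply/andP; split; lra.
Unshelve. all: by end_near. Qed.

Lemma subexponential2 F : (forall x, 0 < tail F x) -> subexponential F ->
  forall e, 0 < e -> \forall x \near +oo,
    tail (convolution F F) x <= (2 + e) * tail F x.
Proof.
move=> F0 /(_ 2%N isT)/ratio_cvgP => /(_ F0) H e /H.
by apply: filterS => x /andP[].
Qed.

(** With a = [tail F y], comparing the shifted lower bound for F * F with (2 + k) [tail F x] leaves
    (a - tail F x) tail F (x - y) <= (a + k) tail F x. *)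
Lemma subexponential_long_tailed F :
  supported_on_Rplus F -> (forall x, 0 < tail F x) ->
  subexponential F -> long_tailed F.
Proof.
move=> Fs F0 FS; apply: slowP => //; first exact: tail_nonincreasing.
move=> y e y0 e0; pose a := tail F y; have a0 : 0 < a by exact: F0.
have e20 : 0 < 2 + e by rewrite addr_gt0.
(* Solves a + k = (1 + e)(a - k). *)
pose k := e * a / (2 + e).
have k0 : 0 < k by rewrite divr_gt0// mulr_gt0.
have kE : k * (2 + e) = e * a by rewrite /k divfK// gt_eqF.
near=> x.
have Fxk : tail F x <= k by near: x; exact: tail_small.
have yx : y <= x by near: x; apply: nbhs_pinfty_ge; rewrite num_real.
have FFx : tail (convolution F F) x <= (2 + k) * tail F x.
  by near: x; exact: subexponential2.
have := le_trans (tail_convolution_ge_shift Fs Fs (ltW y0) yx) FFx.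
rewrite -/a => h.
have h1 : (a - k) * tail F (x - y) <= (a - tail F x) * tail F (x - y).
  by rewrite ler_pM2r//; lra.
have ak : 0 < a - k by nra.
rewrite -(ler_pM2l ak) (@le_trans _ _ ((a + k) * tail F x))//; first lra.
by rewrite mulrA ler_pM2r//; lra.
Unshelve. all: by end_near. Qed.

Lemma subexponential_bigjump_negligible F :
  supported_on_Rplus F -> (forall x, 0 < tail F x) ->
  subexponential F -> bigjump_negligible F F (tail F).
Proof.
move=> Fs F0 FS e e0.
(* One [e / 4] comes from subexponentiality and two from [tail F A], giving 3e/4 in total. *)
have e40 : 0 < e / 4 by rewrite divr_gt0.
near=> A; near=> x.
have A0 : 0 <= A by near: A; apply: nbhs_pinfty_ge; rewrite num_real.
have FA : tail F A <= e / 4 by near: A; exact: tail_small.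
have Ax : A <= x by near: x; apply: nbhs_pinfty_ge; rewrite num_real.
have FFx : tail (convolution F F) x <= (2 + e / 4) * tail F x.
  by near: x; exact: subexponential2.
have := le_trans (tail_convolution_ge Fs Fs A0 Ax) FFx.
have : tail F x * tail F A <= tail F x * (e / 4) by rewrite ler_pM2l.
have := F0 x; nra.
Unshelve. all: by end_near. Qed.

Lemma bigjump_negligible_subexponential F :
  supported_on_Rplus F -> (forall x, 0 < tail F x) ->
  long_tailed F -> bigjump_negligible F F (tail F) -> subexponential F.
Proof.
move=> Fs F0 FL FF [//|n] _; rewrite /nconvolution /=.
(* [iter n] is the (n + 1)-fold convolution, so the induction starts at [F] itself with ratio 1. The
   ratio limit also makes each iterate long-tailed and O of [tail F]. *)
suff [_ []] : supported_on_Rplus (iter n (convolution F) F) /\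
    (forall x, 0 < tail (iter n (convolution F) F) x) /\
    tail (iter n (convolution F) F) x / tail F x @[x --> +oo] --> (n.+1%:R : R).
  by [].
elim: n => [|n [Ks [K0 KF]]] /=.
  split=> //; split=> //; apply: cvg_near_cst; apply: nearW => x.
  by rewrite divff ?gt_eqF.
set K := iter n (convolution F) F in Ks K0 KF *.
split; first exact: convolution_supported.
split.
  apply: tail_gt0 => x x0; apply: lt_le_trans (tail_convolution_ge_max Fs Ks x0).
  by rewrite lt_max F0.
have KL : long_tailed K by exact: (slow_equiv K0 F0 _ KF FL).
have FK : bigjump_negligible F K (fun x => tail F x + tail K x).
  apply: (@bigjump_negligible_weaken _ _ _ _ (tail F) 1) => //.
    by apply: nearW => x; rewrite mul1r lerDl tail_ge0.
  apply: (@bigjump_negligible_le _ _ _ F _ (n.+1%:R + 1)) => //.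
  have /ratio_cvgP := KF; move=> /(_ F0 1 ltr01).
  by apply: filterS => x /andP[].
have h := tail_convolution_equiv Fs Ks F0 K0 FL KL FK.
have : tail (convolution F K) x / (tail F x + tail K x) * (1 + tail K x / tail F x)
    @[x --> +oo] --> (1 * (1 + n.+1%:R) : R).
  by apply: cvgM => //; apply: cvgD => //; exact: cvg_cst.
rewrite mul1r [1 + _]addrC natr1; apply: cvg_trans; apply: near_eq_cvg.
by apply: nearW => x; field; rewrite !gt_eqF// addr_gt0.
Qed.

End asymptotics.

(** * Positive decrease and its stability under sums of tails *)

Section positively_decreasing.
Context {R : realType}.
Implicit Types (F G H : probability R R).

(** The limsup is an infimum of suprema over neighbourhoods, so one supremum is already below [c].
    An extended [c] covers both 1 (positive decrease) and [+oo] (the bounded ratio of tails). *)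
Lemma limf_esup_lt_near (f : R -> R) (c : \bar R) :
  (limf_esup (fun x => (f x)%:E) +oo%R < c)%E ->
  exists2 M : R, (M%:E < c)%E & \forall x \near +oo, f x <= M.
Proof.
move=> /ereal_inf_lt[_ [V FV <-]] sc.
have [x Vx] := @filter_ex _ (pinfty_nbhs R) _ V FV.
have xs : ((f x)%:E <= ereal_sup [set (f x)%:E | x in V])%E.
  by apply: ereal_sup_ubound; exists x.
have sfin : ereal_sup [set (f x)%:E | x in V] \is a fin_num.
  rewrite fin_numE -ltNye -ltey (lt_le_trans (ltNyr (f x)) xs) /=.
  by rewrite (lt_le_trans sc)// leey.
exists (fine (ereal_sup [set (f x)%:E | x in V])); first by rewrite fineK.
apply: filterS FV => y Vy; rewrite -lee_fin fineK//.
by apply: ereal_sup_ubound; exists y.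
Qed.

Lemma limf_esup_le_near (f : R -> R) (M : R) :
  (\forall x \near +oo, f x <= M) ->
  (limf_esup (fun x => (f x)%:E) +oo%R <= M%:E)%E.
Proof.
move=> fM; apply: (@le_trans _ _ (ereal_sup [set (f x)%:E | x in [set x | f x <= M]])).
  by apply: ereal_inf_lbound; exists [set x | f x <= M].
by apply: ge_ereal_sup => _ [x /= fx <-]; rewrite lee_fin.
Qed.

Lemma positively_decreasingP F : (forall x, 0 < tail F x) ->
  positively_decreasing F <->
  exists v c : R, [/\ 1 < v, 0 < c < 1 &
    \forall x \near +oo, tail F (v * x) <= c * tail F x].
Proof.
move=> F0; split.
  move=> [v v1 /limf_esup_lt_near[M]]; rewrite lte_fin => M1 FM.
  (* The maximum with 1/2 makes the constant positive while keeping it below 1. *)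
  exists v, (Num.max M (1 / 2)); split=> //.
    by rewrite lt_max gt_max M1/=; apply/andP; split; [apply/orP; right|]; lra.
  apply: filterS FM => x; rewrite ler_pdivrMr// => /le_trans; apply.
  by rewrite ler_pM2r// le_max lexx.
move=> [v [c [v1 /andP[c0 c1] Fc]]]; exists v => //.
apply: (@le_lt_trans _ _ c%:E); last by rewrite lte_fin.
apply: (@limf_esup_le_near (fun x => tail F (v * x) / tail F x)).
by apply: filterS Fc => x; rewrite ler_pdivrMr.
Qed.

Lemma positively_decreasing_equivD F G H :
  (forall x, 0 < tail F x) -> (forall x, 0 < tail G x) -> (forall x, 0 < tail H x) ->
  tail H x / (tail F x + tail G x) @[x --> +oo] --> (1 : R) ->
  positively_decreasing F -> positively_decreasing G -> positively_decreasing H.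
Proof.
move=> F0 G0 H0 HE /(positively_decreasingP F0)[v1 [c1 [v1_gt1 /andP[c10 c11] Fv]]].
move=> /(positively_decreasingP G0)[v2 [c2 [v2_gt1 /andP[c20 c21] Gv]]].
have FG0 x : 0 < tail F x + tail G x by rewrite addr_gt0.
(* Tails are nonincreasing, so the larger factor and constant serve both laws. *)
pose v := Num.max v1 v2; pose c := Num.max c1 c2.
have v_gt1 : 1 < v by rewrite lt_max v1_gt1.
have c0 : 0 < c by rewrite lt_max c10.
have c1' : c < 1 by rewrite gt_max c11.
(* Then c = 1 - 4e and (1 + e)c <= (1 - e)^2; one factor 1 - e pays for returning from the sum of
   tails to [tail H]. *)
pose e := (1 - c) / 4.
have e0 : 0 < e by rewrite divr_gt0// subr_gt0.
have eE : 4 * e = 1 - c by rewrite /e mulrC divfK.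
have He := (ratio_cvgP (tail H) 1 FG0).1 HE e e0.
(* An explicit threshold, since the estimate is used at both [x] and [v * x]. *)
have [N [_ HN]] := He.
apply/(positively_decreasingP H0); exists v, (1 - e); split=> //.
  by apply/andP; split; lra.
near=> x.
have x0 : 0 < x by near: x; apply: nbhs_pinfty_gt; rewrite num_real.
have Nx : N < x by near: x; apply: nbhs_pinfty_gt; rewrite num_real.
have xvx : x <= v * x by rewrite ler_peMl// ltW.
have /andP[HFG _] := HN _ Nx.
have /andP[_ HvFG] := HN _ (lt_le_trans Nx xvx).
have Fvx : tail F (v * x) <= c * tail F x.
  apply: le_trans (_ : tail F (v1 * x) <= _).
    by apply: tail_nonincreasing; rewrite ler_pM2r// le_max lexx.
  apply: le_trans (_ : c1 * tail F x <= _); first by near: x.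
  by rewrite ler_pM2r// le_max lexx.
have Gvx : tail G (v * x) <= c * tail G x.
  apply: le_trans (_ : tail G (v2 * x) <= _).
    by apply: tail_nonincreasing; rewrite ler_pM2r// le_max lexx orbT.
  apply: le_trans (_ : c2 * tail G x <= _); first by near: x.
  by rewrite ler_pM2r// le_max lexx orbT.
apply: (le_trans HvFG).
apply: (@le_trans _ _ ((1 + e) * (c * (tail F x + tail G x)))).
  by rewrite ler_pM2l; lra.
apply: (@le_trans _ _ ((1 - e) * ((1 - e) * (tail F x + tail G x)))).
  by rewrite !mulrA ler_pM2r//; nra.
by rewrite ler_pM2l; lra.
Unshelve. all: by end_near. Qed.

End positively_decreasing.

(** * The equivalence, and its transfer to random variables *)

Section classA_convolution.
Context {R : realType}.
Implicit Types (F G H : probability R R).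

(* Here J is only o of the tail of the convolution itself; choosing A such
   that J is at most half of that tail lets it be absorbed. *)
Lemma tail_convolution_leD F G :
  (forall x, 0 < tail F x) -> (forall x, 0 < tail G x) ->
  long_tailed F -> long_tailed G ->
  bigjump_negligible F G (tail (convolution F G)) ->
  \forall x \near +oo, tail (convolution F G) x <= 4 * (tail F x + tail G x).
Proof.
move=> F0 G0 FL GL FG; have e0 : 0 < 2^-1 :> R by rewrite invr_gt0.
near (pinfty_nbhs R) => A.
have A0 : A != 0.
  by rewrite gt_eqF//; near: A; apply: nbhs_pinfty_gt; rewrite num_real.
have J : \forall x \near +oo, bigjump F G A x <= 2^-1 * tail (convolution F G) x.
  by near: A; exact: FG.
near=> x.
(* Taking [e = 1] gives a factor 2, which the absorption doubles to 4. *)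
have /andP[_] : (1 - 1) * tail F x <= tail F (x - A) <= (1 + 1) * tail F x.
  by near: x; exact: slow_near.
have /andP[_] : (1 - 1) * tail G x <= tail G (x - A) <= (1 + 1) * tail G x.
  by near: x; exact: slow_near.
have : bigjump F G A x <= 2^-1 * tail (convolution F G) x by near: x.
have := tail_convolution_le F G A x; lra.
Unshelve. all: by end_near. Qed.

(** [H] is tied to the convolution by its tail alone, because the law of the sum is identified with
    [convolution F G] only on measurable sets. *)
Lemma classA_convolution F G H :
  supported_on_Rplus F -> supported_on_Rplus G -> supported_on_Rplus H ->
  (forall x, 0 < tail F x) -> (forall x, 0 < tail G x) ->
  (forall x, tail H x = tail (convolution F G) x) ->
  classT F -> classA G ->
  (limf_esup (fun x : R => (tail G x / tail F x)%:E) +oo%R < +oo)%E ->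
  classA F <-> classA H.
Proof.
move=> Fs Gs Hs F0 G0 HE [FL FP] [GS GP] /limf_esup_lt_near[C _ GCF].
have GF : \forall x \near +oo, tail G x <= C * tail F x.
  by apply: filterS GCF => x; rewrite ler_pdivrMr.
have C0 : 0 < C.
  have [x] := @filter_ex _ (pinfty_nbhs R) _ _ GF.
  by move=> /(lt_le_trans (G0 x)); rewrite pmulr_lgt0.
have C10 : 0 < 1 + C by rewrite addr_gt0.
have GL := subexponential_long_tailed Gs G0 GS.
have FG0 x : 0 < tail F x + tail G x by rewrite addr_gt0.
have FGH : \forall x \near +oo, tail F x <= tail H x /\ tail G x <= tail H x.
  near=> x; have x0 : 0 <= x by near: x; apply: nbhs_pinfty_ge; rewrite num_real.
  by have := tail_convolution_ge_max Fs Gs x0; rewrite ge_max -HE => /andP[].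
have H0 : forall x, 0 < tail H x.
  apply: tail_gt0 => x x0; rewrite HE.
  by apply: lt_le_trans (tail_convolution_ge_max Fs Gs x0); rewrite lt_max F0.
have FH1 : \forall x \near +oo, tail F x <= 1 * tail H x.
  by apply: filterS FGH => x [? _]; rewrite mul1r.
have GH1 : \forall x \near +oo, tail G x <= 1 * tail H x.
  by apply: filterS FGH => x [_ ?]; rewrite mul1r.
have HleF (c : R) : 0 < c ->
    (\forall x \near +oo, tail H x <= c * (tail F x + tail G x)) ->
    \forall x \near +oo, tail H x <= c * (1 + C) * tail F x.
  move=> c0; apply: filterS2 GF => x GFx /le_trans; apply.
  by rewrite -mulrA ler_pM2l// mulrDl mul1r lerD2l.
split=> [[FS _]|[HS _]].
  have FF := subexponential_bigjump_negligible Fs F0 FS.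
  have FG : bigjump_negligible F G (fun x => tail F x + tail G x).
    apply: (@bigjump_negligible_weaken _ _ _ _ (tail F) 1) => //.
      by apply: nearW => x; rewrite mul1r lerDl tail_ge0.
    exact: bigjump_negligible_le GF FF.
  have HFG : tail H x / (tail F x + tail G x) @[x --> +oo] --> (1 : R).
    rewrite (_ : tail H = tail (convolution F G)); last exact/funext.
    exact: tail_convolution_equiv.
  split; last exact: positively_decreasing_equivD HFG FP GP.
  have HL : long_tailed H.
    exact: (slow_equiv H0 FG0 ltr01 HFG (slowD F0 G0 FL GL)).
  have HF : \forall x \near +oo, tail H x <= (1 + 1) * (1 + C) * tail F x.
    apply: HleF => //.
    have := (ratio_cvgP (tail H) 1 FG0).1 HFG 1 ltr01.
    by apply: filterS => x /andP[].
  apply: bigjump_negligible_subexponential => //.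
  (* Since [tail F] is eventually below [tail H], it may serve as the gauge; then each factor [H] is
     replaced by [F] in turn, using symmetry. *)
  apply: (@bigjump_negligible_weaken _ _ _ _ (tail F) 1) => //.
  apply: (bigjump_negligible_le HF); apply: bigjump_negligibleC.
  exact: bigjump_negligible_le HF FF.
split=> //.
have HH := subexponential_bigjump_negligible Hs H0 HS.
have FH : bigjump_negligible F H (tail H).
  by apply: bigjump_negligibleC; exact: bigjump_negligible_le FH1 HH.
have HF : \forall x \near +oo, tail H x <= 4 * (1 + C) * tail F x.
  apply: HleF => //; rewrite (_ : tail H = tail (convolution F G)); last exact/funext.
  apply: tail_convolution_leD => //.
  rewrite -(_ : tail H = tail (convolution F G)); last exact/funext.
  exact: bigjump_negligible_le GH1 FH.
apply: bigjump_negligible_subexponential => //.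
(* [HF] lets the gauge pass from [tail H] back to [tail F]. *)
apply: (@bigjump_negligible_weaken _ _ _ _ (tail H) (4 * (1 + C))) => //.
  by rewrite mulr_gt0.
exact: bigjump_negligible_le FH1 FH.
Unshelve. all: by end_near. Qed.

End classA_convolution.

Unset Implicit Arguments.

Theorem theorem3p1 (R : realType) (d : measure_display) (T : measurableType d)
    (P : probability T R) (X Y : {RV P >-> R})
    (F G FG : probability R R)
    (XF : F = distribution P X) (YG : G = distribution P Y)
    (XYFG : FG = distribution P (X \+ Y))
    (XY : independent_RV X Y)
    (F_supp : supported_on_Rplus F) (G_supp : supported_on_Rplus G)
    (F_tail : forall x : R, 0 <= x -> 0 < tail F x)
    (G_tail : forall x : R, 0 <= x -> 0 < tail G x)
    (FT : classT F) (GA : classA G)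
    (GF : (limf_esup (fun x : R => (tail G x / tail F x)%:E) +oo%R
             < +oo)%E) :
  classA F <-> classA FG.
Proof.
have FGE B : measurable B -> FG B = convolution F G B.
  by move=> mB; rewrite XYFG XF YG; exact: distribution_sum.
apply: (@classA_convolution _ F G) => //.
- by rewrite /supported_on_Rplus FGE//; exact: convolution_supported.
- exact: tail_gt0.
- exact: tail_gt0.
- by move=> x; rewrite /tail FGE.
Qed.
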